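(* Let $d\ge 2$ and $m\ge 2$ be integers. Let $f(d,1,m)$ be the minimum number of sets in an antipodal $(1,m)$-fold cover of $S^d$ with open sets. Then \[ f(d,1,m)=\begin{cases} d+2 & \text{if } m\le \left\lfloor \frac{d}{2}\right\rfloor+1,\\[2pt] \left\lfloor\frac{d-1}{2}\right\rfloor+2+m & \text{if } m\ge \left\lfloor \frac{d}{2}\right\rfloor+1.\end{cases}\]
   Context: $S^d$ denotes the $d$-dimensional unit sphere in $\mathbb{R}^{d+1}$ centered at the origin. A cover of $S^d$ is a (finite) family of subsets of $S^d$; it is an $n$-fold cover if every point of $S^d$ belongs to at least $n$ of the sets. A cover is antipodal if none of its sets contains a pair of antipodal points $x,-x$. The open northern hemisphere is $\{x\in S^d: x_{d+1}>0\}$. For $m>n\ge 1$, an $(n,m)$-fold cover of $S^d$ is an $n$-fold cover of $S^d$ in which every point of the open northern hemisphere belongs to at least $m$ of the sets. *)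

(* Defs.v *)
From HB Require Import structures.
From mathcomp Require Import all_boot all_order all_algebra.
From mathcomp Require Import reals.
Set Implicit Arguments. Unset Strict Implicit. Unset Printing Implicit Defensive.
Import Order.TTheory GRing.Theory Num.Theory.
Local Open Scope ring_scope.

Section Defs.
Variable R : realType.

Definition sphere (d : nat) (x : 'rV[R]_(d.+1)) : Prop :=
  \sum_(i < d.+1) x 0 i ^+ 2 = 1.

Definition edist (d : nat) (x y : 'rV[R]_(d.+1)) : R :=
  Num.sqrt (\sum_(i < d.+1) (x 0 i - y 0 i) ^+ 2).

Definition sphere_open (d : nat) (U : 'rV[R]_(d.+1) -> Prop) : Prop :=
  (forall x, U x -> sphere x) /\
  (forall x, U x -> exists e : R, 0 < e /\
       forall y, sphere y -> edist x y < e -> U y).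

Definition north (d : nat) (x : 'rV[R]_(d.+1)) : Prop := 0 < x 0 ord_max.

Definition antipodal_open_1m_cover (d m n : nat)
    (U : 'I_n -> 'rV[R]_(d.+1) -> Prop) : Prop :=
  [/\ (forall i, sphere_open (U i)),
      (forall i x, U i x -> U i (- x) -> False),
      (forall x, sphere x -> exists i, U i x) &
      (forall x, sphere x -> north x ->
         exists S : {set 'I_n}, (m <= #|S|)%N /\ forall i, i \in S -> U i x)].

End Defs.

(* Main.v *)
(** Lower bounds. Let [theta] be an involution of the space flipping the signs of some coordinates,
and label each point [x] of the cross-polytope by the index [lam x] of a set of the cover containing
a whole neighbourhood of it, and by the sign [+] or the sign [-] according to whether [lam x] or
[lam (theta x)] is the smaller one (which is then the label). On a fine subdivision of a hemisphere
whose boundary is made of points with [theta x = -x], Fan's lemma yields a simplex whose [K+1]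
signed labels alternate in sign; the discarded label of the last vertex extends the alternation to
length [K+2].
With [theta = -id] and [K = d] this is the bound [n >= d+2]. For the other bound, [theta] keeps the
last coordinate and the hemisphere, of dimension [K = 2r+1] with [r = floor((d-1)/2)], is a southern
one: [theta x = -x] is needed on its equator only, and of the [2r+3] interlacing labels [r+2] belong
to one southern point. Pushed into the open south, this point lies in [r+2] sets and its antipode in
[m] others.

Upper bound. Put [y = (x_0, ..., x_{d-1}, 0)] and let [t] be the (odd) average of the [p]-th largest
and the [p]-th smallest entry of [y], minus the height [x_d], where [p = floor(d/2)+1]. The sets are
[y_j > t] for [j <= d], the set where [t] exceeds the midrange of [y], and copies of the northern
hemisphere. *)

From HB Require Import structures.
From mathcomp Require Import all_boot all_order all_algebra.
From mathcomp Require Import zify lra.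
From mathcomp Require Import boolp classical_sets reals topology normedtype sequences realfun.
Require Import Defs.
Set Implicit Arguments. Unset Strict Implicit. Unset Printing Implicit Defensive.
Import Order.TTheory GRing.Theory Num.Theory numFieldNormedType.Exports.

(** * Chains modulo 2 and barycentric subdivision *)

Section Chains.
Variable V : eqType.
Implicit Types (s t : seq V) (c : seq (seq V)) (f g : seq V -> bool).

(** A simplex is a list of vertices and a chain a list of simplices. The empty list is a face of
    every single vertex, so the complex is augmented. *)
Fixpoint faces s : seq (seq V) :=
  if s is x :: s' then s' :: map (cons x) (faces s') else [::].

(** Chains are compared through their pairing with mod 2 cochains, in which repeated simplices
    cancel by themselves. *)
Definition parity c f : bool := \big[addb/false]_(s <- c) f s.

Definition cobd f s : bool := parity (faces s) f.
Arguments cobd : simpl never.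

Lemma parity_cat c1 c2 f : parity (c1 ++ c2) f = parity c1 f (+) parity c2 f.
Proof. by rewrite /parity big_cat. Qed.

Lemma parity_cons s c f : parity (s :: c) f = f s (+) parity c f.
Proof. by rewrite /parity big_cons. Qed.

Lemma parity_map (h : seq V -> seq V) c f : parity (map h c) f = parity c (f \o h).
Proof. by rewrite /parity big_map. Qed.

Lemma parity_add c f g : parity c (fun s => f s (+) g s) = parity c f (+) parity c g.
Proof. by rewrite /parity big_split. Qed.

Lemma eq_parity_in c f g : {in c, f =1 g} -> parity c f = parity c g.
Proof. by move=> fg; rewrite /parity; apply: eq_big_seq. Qed.

Lemma eq_parity c f g : f =1 g -> parity c f = parity c g.
Proof. by move=> fg; apply: eq_parity_in => s _. Qed.

Lemma parity_flatten (h : seq V -> seq (seq V)) c f :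
  parity (flatten (map h c)) f = parity c (fun s => parity (h s) f).
Proof.
elim: c => [|s c IH]; first by rewrite /parity !big_nil.
by rewrite /= parity_cat IH parity_cons.
Qed.

Lemma cobd_nil f : cobd f [::] = false.
Proof. by rewrite /cobd /parity big_nil. Qed.

Lemma cobd_cons f x s : cobd f (x :: s) = f s (+) cobd (f \o cons x) s.
Proof. by rewrite /cobd /= parity_cons parity_map. Qed.

Lemma eq_cobd f g : f =1 g -> cobd f =1 cobd g.
Proof. by move=> fg s; apply: eq_parity. Qed.

Lemma cobd_add f g s : cobd (fun t => f t (+) g t) s = cobd f s (+) cobd g s.
Proof. exact: parity_add. Qed.

Lemma cobd_cobd f s : cobd (cobd f) s = false.
Proof.
elim: s f => [|x s IH] f; first exact: cobd_nil.
rewrite cobd_cons [X in _ (+) X](@eq_cobd _ (fun t => f t (+) cobd (f \o cons x) t)); last first.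
  by move=> t; rewrite /= cobd_cons.
by rewrite cobd_add IH addbF addbb.
Qed.

Lemma faces_size s t : t \in faces s -> (size t).+1 = size s.
Proof.
elim: s t => //= x s IH t; rewrite inE => /predU1P[-> //|/mapP[u us ->]] /=.
by rewrite IH.
Qed.

Lemma faces_subseq s t : t \in faces s -> subseq t s.
Proof.
elim: s t => //= x s IH t; rewrite inE => /predU1P[->|/mapP[u us ->]] /=.
  exact: subseq_cons.
by rewrite eqxx IH.
Qed.

Lemma faces_map (h : V -> V) s : faces (map h s) = map (map h) (faces s).
Proof.
elim: s => //= x s ->; congr cons; rewrite -!map_comp; exact: eq_map.
Qed.

(** For a symmetric cochain it does not matter which copy of a repeated vertex is deleted; in this
    form the sum can be reindexed along a permutation. *)
Lemma cobd_rem f s : (forall t u, perm_eq t u -> f t = f u) ->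
  cobd f s = \big[addb/false]_(x <- s) f (rem x s).
Proof.
elim: s f => [|y s IH] f fP; first by rewrite cobd_nil big_nil.
rewrite cobd_cons big_cons /= eqxx; congr addb.
rewrite IH; last by move=> t u tu; apply: fP; rewrite perm_cons.
apply: eq_big_seq => x xs /=; case: eqP => // ->.
by apply: fP; rewrite perm_sym perm_to_rem.
Qed.

Lemma cobd_perm f s t : (forall t u, perm_eq t u -> f t = f u) ->
  perm_eq s t -> cobd f s = cobd f t.
Proof.
move=> fP st; rewrite !cobd_rem // (perm_big _ st) /=.
apply: eq_big_seq => x xt; apply: fP; rewrite -(perm_cons x).
have xs : x \in s by rewrite (perm_mem st).
by rewrite -(permPl (perm_to_rem xs)) (permPl st) perm_to_rem.
Qed.

End Chains.
Arguments cobd {V} : simpl never.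

Lemma cobd_comp_map (V W : eqType) (h : V -> W) f (s : seq V) :
  cobd (f \o map h) s = cobd f (map h s).
Proof.
elim: s f => [|x s IH] f; first by rewrite !cobd_nil.
by rewrite /= !cobd_cons /= -IH.
Qed.

(** * Barycentric subdivision as a chain map, and hemispheres built as cones *)

Section Subdivision.
Variables (V : eqType) (bary : seq V -> V).
Implicit Types (s t : seq V) (c : seq (seq V)) (f g : seq V -> bool).

(** The cone from the barycentre over the subdivided boundary. Faces are not structural subterms, so
    the recursion runs on a fuel [n], which [sd] sets to the number of vertices. *)
Fixpoint sd_rec n s : seq (seq V) :=
  if n is n'.+1 then map (cons (bary s)) (flatten (map (sd_rec n') (faces s)))
  else [:: s].

Definition sd s := sd_rec (size s) s.

Definition subdiv c := flatten (map sd c).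

Lemma sd_cons x s :
  sd (x :: s) = map (cons (bary (x :: s))) (subdiv (faces (x :: s))).
Proof.
rewrite /sd /subdiv; congr (map _ (flatten _)).
apply/eq_in_map => t /faces_size.
by case=> st; rewrite /sd st.
Qed.

Lemma subdivP c t : t \in subdiv c -> exists2 s, s \in c & t \in sd s.
Proof. by move/flatten_mapP => [s sc ts]; exists s. Qed.

Lemma sd_size s t : t \in sd s -> size t = size s.
Proof.
move: {2}(size s) (erefl (size s)) => n; elim: n s t => [|n IH] [|x s] t //=.
  by rewrite inE => _ /eqP->.
case=> sn; rewrite sd_cons => /mapP[u /subdivP[v vs uv] ->] /=.
have [vn] := faces_size vs.
by rewrite (IH v) // vn.
Qed.

Lemma sd_ind (P : seq V -> seq V -> Prop) :
  P [::] [::] ->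
  (forall s v u, s != [::] -> v \in faces s -> u \in sd v -> P v u ->
     P s (bary s :: u)) ->
  forall s t, t \in sd s -> P s t.
Proof.
move=> P0 PS s; move: {2}(size s) (erefl (size s)) => n.
elim: n s => [|n IH] [|x s] //= => [_ t|[sn] t].
  by rewrite inE => /eqP->.
rewrite sd_cons => /mapP[u /subdivP[v vs uv] ->]; apply: (PS _ v) => //.
by apply: IH => //; have [->] := faces_size vs.
Qed.

Lemma parity_subdiv c f : parity (subdiv c) f = parity c (fun s => parity (sd s) f).
Proof. exact: parity_flatten. Qed.

(** Subdivision is a chain map: for nonempty [s], the boundary of the cone [sd s] is its base plus a
    cone over the boundary of a boundary, which vanishes by [cobd_cobd]. *)
Lemma cobd_sd f s : cobd (fun t => parity (sd t) f) s = parity (sd s) (cobd f).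
Proof.
move: {2}(size s) (erefl (size s)) => n; elim: n s f => [|n IH] [|x s] //= f.
  by rewrite cobd_nil /parity big_seq1 cobd_nil.
case=> sn; rewrite sd_cons parity_map parity_subdiv.
set b := bary _; set F := faces _.
rewrite -/(parity F _).
rewrite [RHS](@eq_parity_in _ _ _ (fun t => parity (sd t) f (+)
    cobd (fun u => parity (sd u) (f \o cons b)) t)).
  by rewrite parity_add -/(cobd _ (x :: s)) -/(cobd (cobd _) (x :: s)) cobd_cobd addbF.
move=> t tF; rewrite IH; last by have [->] := faces_size tF.
rewrite -parity_add; apply: eq_parity => u /=; exact: cobd_cons.
Qed.

Variable theta : V -> V.
Hypothesis bary_theta : forall s, bary (map theta s) = theta (bary s).

Lemma sd_map s : sd (map theta s) = map (map theta) (sd s).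
Proof.
move: {2}(size s) (erefl (size s)) => n; elim: n s => [|n IH] [|x s] //= [sn].
rewrite (sd_cons (theta x)) -[theta x :: _]/(map theta (x :: s)) bary_theta.
rewrite sd_cons faces_map /subdiv -!map_comp.
rewrite [RHS](@eq_map _ _ _ (cons (theta (bary (x :: s))) \o map theta)) //.
rewrite [RHS]map_comp; congr map.
rewrite map_flatten -map_comp; congr flatten.
apply/eq_in_map => t tF /=; rewrite IH //.
by have [->] := faces_size tF.
Qed.

Hypothesis thetaK : involutive theta.
Variable p : nat -> V.

(** A hemisphere of dimension [k] is a cone with apex [p k] over a sphere of dimension [k - 1],
    itself glued from a smaller hemisphere and its image under [theta]. *)
Fixpoint hemi k : seq (seq V) :=
  if k is k'.+1 then map (cons (p k)) (hemi k' ++ map (map theta) (hemi k'))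
  else [:: [:: p 0]].

Definition fine_hemi N k := iter N subdiv (hemi k).

Lemma hemi_size k s : s \in hemi k -> size s = k.+1.
Proof.
elim: k s => [|k IH] s; first by rewrite inE => /eqP->.
move=> /mapP[t tk ->] /=; congr S; move: tk; rewrite mem_cat => /orP[/IH //|].
by move=> /mapP[u /IH uk ->]; rewrite size_map.
Qed.

Lemma fine_size N k s : s \in fine_hemi N k -> size s = k.+1.
Proof.
rewrite /fine_hemi; elim: N s => [|N IH] s; first exact: hemi_size.
by rewrite iterS => /subdivP[t /IH <- /sd_size].
Qed.

(** The base of the cone gives the right-hand side. The cone over the boundary of the base cancels:
    both halves of the base sphere have the same boundary, as [theta] is an involution. *)
Lemma hemi_boundary k f :
  parity (hemi k.+1) (cobd f) = parity (hemi k) f (+) parity (hemi k) (f \o map theta).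
Proof.
have hemiS j : hemi j.+1 =
    map (cons (p j.+1)) (hemi j ++ map (map theta) (hemi j)) by [].
elim: k f => [|k IH] f; rewrite hemiS parity_map.
  by rewrite /parity !big_cons !big_nil /= !cobd_cons !cobd_nil /= !addbF addbACA addbb addbF.
move: (hemi k.+1) IH => C IH.
rewrite (@eq_parity _ _ _ (fun t => f t (+) cobd (f \o cons (p k.+2)) t)); last first.
  by move=> t; rewrite /= cobd_cons.
rewrite parity_add !parity_cat !parity_map -[RHS]addbF; congr addb.
set g := _ \o cons _.
rewrite [X in _ (+) X](@eq_parity _ _ _ (cobd (g \o map theta))); last first.
  by move=> t; rewrite [RHS]cobd_comp_map.
rewrite !IH [X in _ (+) (_ (+) X)](@eq_parity _ _ _ g).
  by rewrite [X in _ (+) X]addbC addbb.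
by move=> t /=; rewrite mapK.
Qed.

Lemma fine_boundary N k f :
  parity (fine_hemi N k.+1) (cobd f) =
  parity (fine_hemi N k) f (+) parity (fine_hemi N k) (f \o map theta).
Proof.
rewrite /fine_hemi; elim: N f => [|N IH] f; first exact: hemi_boundary.
rewrite !iterS !parity_subdiv -(eq_parity _ (cobd_sd f)) IH; congr addb.
by apply: eq_parity => s /=; rewrite sd_map parity_map.
Qed.

Lemma fine_augmentation N f : parity (fine_hemi N 0) (cobd f) = f [::].
Proof.
rewrite /fine_hemi; elim: N f => [|N IH] f.
  by rewrite /parity big_seq1 cobd_cons cobd_nil addbF.
by rewrite iterS parity_subdiv -(eq_parity _ (cobd_sd f)) IH /parity big_seq1.
Qed.

End Subdivision.

(** * Alternating sign patterns *)

Fixpoint alternates (b : bool) (w : seq bool) : bool :=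
  if w is c :: w' then (c == b) && alternates (~~ b) w' else true.

(** A nonempty alternating word has exactly one deletion leaving an alternating word with start [b]:
    that of its last letter if it starts with [b], of its first otherwise. Any other word has none
    or two, the latter when two equal neighbours can each be deleted. *)
Lemma cobd_alternates b w :
  cobd (alternates b) w = alternates b w (+) alternates (~~ b) w.
Proof.
elim: w b => [|c w IH] b; first by rewrite cobd_nil.
rewrite cobd_cons.
have -> : cobd (alternates b \o cons c) w = (c == b) && cobd (alternates (~~ b)) w.
  case cb: (c == b).
    by apply: eq_cobd => t /=; rewrite cb.
  by rewrite /cobd /parity big1 // => t _ /=; rewrite cb.
by rewrite IH negbK /=; case: c b => [] [] /=; rewrite ?addbF //; case: alternates; case: alternates.
Qed.

Lemma alternates_negb b w : alternates b (map negb w) = alternates (~~ b) w.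
Proof. by elim: w b => //= c w IH b; rewrite IH; case: c; case: b. Qed.

(** The parity of a label is its sign, read in increasing order of labels. Equal labels have equal
    signs, so a repetition destroys the alternation. *)
Definition alt_labels (V : eqType) (mu : V -> nat) b (s : seq V) : bool :=
  alternates b (map odd (sort leq (map mu s))).

Lemma cobd_alt_labels (V : eqType) (mu : V -> nat) b (s : seq V) :
  cobd (alt_labels mu b) s = alt_labels mu b s (+) alt_labels mu (~~ b) s.
Proof.
pose G l := alternates b (map odd (sort leq l)).
have GP l l' : perm_eq l l' -> G l = G l'.
  move=> ll'; rewrite /G; congr (alternates _ (map _ _)).
  by apply/perm_sortP => //; [exact: leq_total|exact: leq_trans|exact: anti_leq].
rewrite (@eq_cobd _ _ (G \o map mu)) // cobd_comp_map.
set l := map mu s; have sl : perm_eq l (sort leq l) by rewrite perm_sym perm_sort.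
rewrite (cobd_perm GP sl).
transitivity (cobd (alternates b \o map odd) (sort leq l)).
  apply: eq_parity_in => t /faces_subseq tl; rewrite /G /=; congr (alternates _ (map _ _)).
  apply: sorted_sort; first exact: leq_trans.
  apply: subseq_sorted tl _; first exact: leq_trans.
  exact: sort_sorted leq_total _.
by rewrite cobd_comp_map cobd_alternates.
Qed.

(** * Fan's lemma *)

Section Fan.
Variables (V : eqType) (bary : seq V -> V) (theta : V -> V) (p : nat -> V).
Hypothesis bary_theta : forall s, bary (map theta s) = theta (bary s).
Hypothesis thetaK : involutive theta.
Variables (N K : nat).
Local Notation fine_hemi := (fine_hemi bary theta p N).

(** Summing [cobd_alt_labels] over the hemisphere leaves its boundary; there the half moved by
    [theta] contributes the patterns of opposite start on the smaller hemisphere. The parity thus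
    descends to dimension 0, where the empty simplex counts once. *)
Lemma fan_parity (mu : V -> nat) :
  (forall k s b, (k < K)%N -> s \in fine_hemi k ->
     alt_labels mu b (map theta s) = alt_labels mu (~~ b) s) ->
  parity (fine_hemi K) (fun s => alt_labels mu true s (+) alt_labels mu false s) = true.
Proof.
elim: K => [|k IH] swap.
  rewrite -(eq_parity _ (cobd_alt_labels mu true)).
  by rewrite fine_augmentation.
rewrite -(eq_parity _ (cobd_alt_labels mu true)) fine_boundary // -[RHS]IH; last first.
  by move=> j s b jk; apply: swap; rewrite ltnW.
rewrite parity_add; congr addb; apply: eq_parity_in => s sk /=.
exact: (swap k).
Qed.

Variable lam : V -> nat.

(* The signed label [+j] is encoded as [2j] and [-j] as [2j+1]. *)
Definition signed_label (x : V) : nat := minn (lam x).*2 (lam (theta x)).*2.+1.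

Lemma sort_map_mono (mu nu : V -> nat) (s : seq V) :
  {in s &, forall x y, mu x <= mu y -> nu x <= nu y} ->
  sort leq (map nu s) = map nu (sort (relpre mu leq) s).
Proof.
move=> mono.
have srt : sorted leq (map nu (sort (relpre mu leq) s)).
  rewrite sorted_map.
  have : sorted (relpre mu leq) (sort (relpre mu leq) s).
    by apply: sort_sorted => x y /=; apply: leq_total.
  apply: (@sub_in_sorted _ (mem s)); last by apply/allP => x; rewrite mem_sort.
  by move=> x y xs ys /=; apply: mono.
rewrite -(sorted_sort leq_trans srt); apply/perm_sortP.
- exact: leq_total.
- exact: leq_trans.
- exact: anti_leq.
by apply: perm_map; rewrite perm_sym perm_sort.
Qed.

(** [theta] keeps the half of each signed label and changes its parity. The order survives because
    the hypothesis forbids two vertices of [s] to carry the same half with opposite signs. *)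
Lemma signed_label_swap b (s : seq V) :
  {in s &, forall x y, lam x <> lam (theta y)} ->
  alt_labels signed_label b (map theta s) = alt_labels signed_label (~~ b) s.
Proof.
move=> opp; rewrite /alt_labels -map_comp.
rewrite (@sort_map_mono signed_label (signed_label \o theta)); last first.
  move=> x y xs ys /=; rewrite /signed_label !thetaK.
  have := opp x y xs ys; have := opp y x ys xs.
  have := opp x x xs xs; have := opp y y ys ys; lia.
rewrite [in RHS](@sort_map_mono signed_label signed_label) // -alternates_negb.
congr alternates; rewrite -!map_comp; apply/eq_in_map => x.
rewrite mem_sort => xs /=; rewrite /signed_label thetaK.
have := opp x x xs xs; lia.
Qed.

Lemma alternates_extend b (w : seq bool) c :
  alternates b (rcons w c) = alternates b w && (c == b (+) odd (size w)).
Proof.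
elim: w b => [|a w IH] b /=; first by rewrite andbT addbF.
by rewrite IH -andbA; case: b; case: (odd _).
Qed.

Lemma ltn_sorted_alternating b (l : seq nat) :
  sorted leq l -> alternates b (map odd l) -> sorted ltn l.
Proof.
case: l => //= x l; elim: l x b => //= y l IH x b /andP[xy yl] /andP[xb /andP[yb lb]].
apply/andP; split; last by apply: (IH y (~~ b)) => //=; rewrite yb.
by rewrite ltn_neqAle xy andbT; apply/eqP => xyE; move: xb yb; rewrite xyE => /eqP->; case: b {lb}.
Qed.

(** Through its parity each label in [l] still tells whether it comes from [lam x] or from
    [lam (theta x)], hence which set of the cover it names. *)
Lemma alternating_extension b (s : seq V) : s != [::] ->
  alt_labels signed_label b s ->
  exists l : seq nat, [/\ sorted ltn l, size l = (size s).+1,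
    alternates b (map odd l) &
    forall j, j \in l -> exists2 x, x \in s &
      j = if odd j then (lam (theta x)).*2.+1 else (lam x).*2].
Proof.
move=> s0; rewrite /alt_labels.
set l0 := sort leq _ => alt0.
have szl0 : size l0 = size s by rewrite size_sort size_map.
have srt : sorted ltn l0.
  by apply: ltn_sorted_alternating alt0; apply: sort_sorted; apply: leq_total.
have inl j : j \in l0 -> exists2 x, x \in s & j = signed_label x.
  by rewrite mem_sort => /mapP[x xs ->]; exists x.
case: l0 srt alt0 szl0 inl => [|y l]; first by move=> _ _ /esym/eqP; rewrite size_eq0 (negbTE s0).
move=> srt alt0 szl0 inl.
have [v vs av] := inl _ (mem_last y l).
set a := last y l in av.
(* [c] is the candidate that lost the minimum defining [a]; it has the other parity, so it is
   strictly larger. *)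
pose c := if odd a then (lam v).*2 else (lam (theta v)).*2.+1.
have ac : (a < c)%N by rewrite /c; case: ifP; rewrite av /signed_label; lia.
have oc : odd c = ~~ odd a by rewrite /c; case: (odd a) => /=; rewrite odd_double.
exists (rcons (y :: l) c); split.
- by rewrite /= rcons_path; apply/andP.
- by rewrite size_rcons szl0.
- rewrite map_rcons alternates_extend alt0 /= size_map oc.
  move: alt0; rewrite lastI map_rcons alternates_extend => /andP[_ /eqP].
  by rewrite -/a size_map size_belast => ->; case: b {srt}; case: odd.
move=> j; rewrite mem_rcons inE => /predU1P[->|/inl[x xs jx]].
  exists v => //; rewrite oc /c; case: (odd a) => //=.
exists x => //; rewrite jx /signed_label.
by case: (leqP (lam x).*2 (lam (theta x)).*2.+1); rewrite /= odd_double.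
Qed.

Lemma odd_alternating b (w : seq bool) :
  alternates b w -> count id w = (b + size w)./2.
Proof.
elim: w b => [|c w IH] b /=; first by case: b.
by move=> /andP[/eqP-> /IH ->]; case: b => /=; lia.
Qed.

(** [P] and [Q] are the halves of the even and of the odd labels among [K + 2] alternating ones.
    Halving is injective on each parity, and alternation makes the two sizes differ by at most
    one. *)
Theorem fan_interlacing :
  (forall k s, (k < K)%N -> s \in fine_hemi k ->
     {in s &, forall x y, lam x <> lam (theta y)}) ->
  exists s P Q, [/\ s \in fine_hemi K, uniq P /\ uniq Q,
    {subset P <= map lam s}, {subset Q <= map (lam \o theta) s} &
    (size P + size Q = K.+2)%N /\ (maxn (size P) (size Q) = K.+1./2.+1)%N].
Proof.
move=> opp.
have par := @fan_parity signed_label (fun k s b kK sk => signed_label_swap b (opp k s kK sk)).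
have [s sK [b alt]] : exists2 s, s \in fine_hemi K & exists b, alt_labels signed_label b s.
  case: (boolP (has (fun s => alt_labels signed_label true s || alt_labels signed_label false s) (fine_hemi K))).
    by move=> /hasP[s sK /orP[]]; exists s => //; [exists true|exists false].
  move=> /hasPn none; move: par; rewrite /parity big1_seq // => s /andP[_ /none].
  by rewrite negb_or => /andP[/negbTE-> /negbTE->].
have szs := fine_size sK.
have [|l [srt szl altl inl]] := alternating_extension _ alt; first by rewrite -size_eq0 szs.
have ul : uniq l := sorted_uniq ltn_trans ltnn srt.
pose P := [seq j./2 | j <- l & ~~ odd j]; pose Q := [seq j./2 | j <- l & odd j].
have := odd_alternating altl; rewrite count_map size_map szl szs.
rewrite (@eq_count _ _ odd) // => cQ.
have cP : (count (fun j => ~~ odd j) l + count odd l = K.+2)%N.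
  by rewrite addnC count_predC szl szs.
exists s, P, Q; split => //.
- split; rewrite map_inj_in_uniq ?filter_uniq // => i j; rewrite !mem_filter.
    by move=> /andP[oi _] /andP[oj _] ij; rewrite -(even_halfK oi) -(even_halfK oj) ij.
  by move=> /andP[oi _] /andP[oj _] ij; rewrite -(odd_double_half i) -(odd_double_half j) oi oj ij.
- move=> j /mapP[i]; rewrite mem_filter => /andP[/negbTE oi /inl[x xs]].
  by rewrite oi => -> ->; rewrite doubleK map_f.
- move=> j /mapP[i]; rewrite mem_filter => /andP[oi /inl[x xs]].
  by rewrite oi => -> ->; rewrite /= uphalf_double; apply: (map_f (lam \o theta)).
rewrite !size_map !size_filter -[count [eta odd] l]/(count odd l); split => //.
move: cP cQ; move: (count _ l) (count _ l) => e o; case: b {alt altl} => /=; rewrite ?uphalf_half; lia.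
Qed.

End Fan.

Local Open Scope ring_scope.

(** * Fine hemispheres of the cross-polytope *)

Section Mesh.
Variables (R : realType) (d : nat).
Local Notation V := 'rV[R]_d.
Implicit Types (s t : seq V) (x y : V) (D e : R).

Definition bary s : V := (size s)%:R^-1 *: \sum_(x <- s) x.

Lemma baryE s j : bary s 0 j = (size s)%:R^-1 * \sum_(x <- s) x 0 j.
Proof. by rewrite mxE summxE. Qed.

Lemma mean_ge0 s (f : V -> R) : {in s, forall x, 0 <= f x} ->
  0 <= (size s)%:R^-1 * \sum_(x <- s) f x.
Proof. by move=> f0; rewrite mulr_ge0 ?invr_ge0 ?ler0n // big_seq sumr_ge0. Qed.

Lemma mean_cst s (c : R) : s != [::] -> (size s)%:R^-1 * \sum_(x <- s) c = c.
Proof.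
move=> s0; rewrite big_const_seq count_predT iter_addr_0 -[c *+ _]mulr_natl mulKf //.
by rewrite pnatr_eq0 size_eq0.
Qed.

Lemma sd_bary_closed (Q : V -> Prop) :
  (forall s, s != [::] -> {in s, forall x, Q x} -> Q (bary s)) ->
  forall s t, t \in sd bary s -> {in s, forall x, Q x} -> {in t, forall x, Q x}.
Proof.
move=> Qb; apply: sd_ind => // s v u s0 vs _ IH Qs x.
rewrite inE => /predU1P[->|]; first exact: Qb.
by apply: IH => y yv; apply: Qs; apply: (mem_subseq (faces_subseq vs)).
Qed.

Lemma sd_bary_near s t c e j : t \in sd bary s ->
  {in s, forall x, `|x 0 j - c| <= e} -> {in t, forall x, `|x 0 j - c| <= e}.
Proof.
apply: sd_bary_closed => {}s s0 H; rewrite baryE -(mean_cst c s0) -mulrBr -sumrB.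
rewrite normrM gtr0_norm ?invr_gt0 ?ltr0n ?lt0n ?size_eq0 // -[leRHS](mean_cst e s0).
rewrite ler_wpM2l ?invr_ge0 ?ler0n //; apply: le_trans (ler_norm_sum _ _ _) _.
by rewrite big_seq [leRHS]big_seq; apply: ler_sum.
Qed.

Definition mesh_le e s : Prop :=
  {in s &, forall x y, forall j, `|x 0 j - y 0 j| <= e}.

(** In the mean of the differences to [x] the term of [x] itself vanishes, leaving one term fewer
    than there are vertices. *)
Lemma bary_vertex D s x j : x \in s -> mesh_le D s ->
  `|bary s 0 j - x 0 j| <= (size s).-1%:R / (size s)%:R * D.
Proof.
move=> xs sD; have s0 : s != [::] by case: s xs {sD}.
have sp : 0 < (size s)%:R :> R by rewrite ltr0n lt0n size_eq0.
rewrite baryE -{1}(mean_cst (x 0 j) s0) -mulrBr -sumrB (perm_big _ (perm_to_rem xs)) /=.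
rewrite big_cons subrr add0r normrM gtr0_norm ?invr_gt0 // mulrAC [leRHS]mulrC.
rewrite ler_pM2l ?invr_gt0 //; apply: le_trans (ler_norm_sum _ _ _) _.
apply: (@le_trans _ _ (\sum_(y <- rem x s) D)).
  rewrite big_seq [leRHS]big_seq; apply: ler_sum => y ys.
  by apply: sD => //; apply: mem_rem ys.
by rewrite big_const_seq count_predT iter_addr_0 size_rem // mulr_natl.
Qed.

Lemma ratio_mono (m n : nat) : (m <= n)%N -> m%:R / m.+1%:R <= n%:R / n.+1%:R :> R.
Proof.
move=> mn; rewrite ler_pdivrMr ?ltr0n // mulrAC ler_pdivlMr ?ltr0n //.
by rewrite -!natrM ler_nat; lia.
Qed.

(** Two vertices of [t] both belong to the subdivision of a face, where induction gives a smaller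
    ratio, or one of them is the barycentre of [s] and [bary_vertex] applies. *)
Lemma sd_mesh D s t : 0 <= D -> t \in sd bary s -> mesh_le D s ->
  mesh_le ((size s).-1%:R / (size s)%:R * D) t.
Proof.
move=> D0; move: s t; apply: sd_ind => // s v u s0 vs uv IH sD.
have vsub := mem_subseq (faces_subseq vs).
have uD : mesh_le ((size s).-1%:R / (size s)%:R * D) u.
  have vD : mesh_le D v by move=> x y xv yv; apply: sD; apply: vsub.
  move=> x y xu yu j; apply: le_trans (IH vD x y xu yu j) _.
  rewrite ler_wpM2r // -(faces_size vs) /=.
  case: (size v) => [|m]; last exact: ratio_mono.
  by rewrite /= !mul0r.
have bu y j : y \in u -> `|bary s 0 j - y 0 j| <= (size s).-1%:R / (size s)%:R * D.
  move=> yu; rewrite distrC.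
  apply: (sd_bary_near uv _ yu) => x /vsub xs.
  by rewrite distrC; apply: bary_vertex.
move=> x y; rewrite !inE => /predU1P[->|xu] /predU1P[->|yu] j.
- by rewrite subrr normr0 !mulr_ge0 ?invr_ge0 ?ler0n.
- exact: bu.
- by rewrite distrC; apply: bu.
- exact: uD.
Qed.

Lemma iter_subdiv_mesh (K N : nat) D c : 0 <= D ->
  {in c, forall s, (size s <= K.+1)%N /\ mesh_le D s} ->
  {in iter N (subdiv bary) c, forall s, (size s <= K.+1)%N /\
     mesh_le ((K%:R / K.+1%:R) ^+ N * D) s}.
Proof.
move=> D0 cD; elim: N => [|N IH] s; first by rewrite expr0 mul1r; apply: cD.
rewrite iterS => /subdivP[t /IH[tK tD] st]; rewrite (sd_size st); split => //.
have qD : 0 <= (K%:R / K.+1%:R) ^+ N * D by rewrite mulr_ge0 ?exprn_ge0 ?divr_ge0 ?ler0n.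
move=> x y xs ys j; apply: le_trans (sd_mesh qD st tD xs ys j) _.
rewrite exprS -[leRHS]mulrA ler_wpM2r //.
by move: tK; case: (size t) => [|m] mK; [rewrite mul0r divr_ge0 ?ler0n|apply: ratio_mono].
Qed.

Lemma iter_subdiv_small (K : nat) D e : 0 <= D -> 0 < e ->
  exists N, forall c, {in c, forall s, (size s <= K.+1)%N /\ mesh_le D s} ->
  {in iter N (subdiv bary) c, forall s, mesh_le e s}.
Proof.
move=> D0 e0.
have [N Ne] : exists N, (K%:R / K.+1%:R) ^+ N * D <= e.
  have q1 : `|K%:R / K.+1%:R| < 1 :> R.
    rewrite ger0_norm ?divr_ge0 ?ler0n // ltr_pdivrMr ?ltr0n // mul1r ltr_nat //.
  have D1 : 0 < e / (D + 1) by rewrite divr_gt0 // ltr_wpDl.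
  have [N _ /(_ N (leqnn N))] := (cvgr0Pnorm_lt _).1 (cvg_expr q1) _ D1.
  move=> /ltW /(le_trans (ler_norm _)) H; exists N.
  apply: (@le_trans _ _ (e / (D + 1) * D)); first by rewrite ler_wpM2r.
  by rewrite mulrAC ler_pdivrMr ?ltr_wpDl // mulrDr mulr1 lerDl ltW.
exists N => c /(iter_subdiv_mesh D0) H s /(H N)[_ sD] x y xs ys j.
exact: le_trans (sD x y xs ys j) Ne.
Qed.

End Mesh.

Section CrossPolytope.
Variables (R : realType) (d : nat).
Local Notation V := 'rV[R]_d.
Implicit Types (s t : seq V) (x y : V).

Definition flip (f : 'I_d -> bool) x : V := \row_j ((-1) ^+ f j * x 0 j).

Lemma flipK f : involutive (flip f).
Proof. by move=> x; apply/rowP => j; rewrite !mxE mulrA -signr_addb addbb mul1r. Qed.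

Lemma bary_flip f s : bary (map (flip f) s) = flip f (bary s).
Proof.
apply/rowP => j; rewrite baryE mxE baryE size_map big_map mulrCA; congr (_ * _).
by rewrite mulr_sumr; apply: eq_bigr => x _; rewrite mxE.
Qed.

(** The facet of the cross-polytope with signs [eps]. The l1 norm is linear on it, so barycentres
    stay in the facet. *)
Definition orthant (eps : 'I_d -> bool) x : Prop :=
  (forall j, 0 <= (-1) ^+ eps j * x 0 j) /\ \sum_j (-1) ^+ eps j * x 0 j = 1.

Definition l1sphere x : Prop := \sum_j `|x 0 j| = 1.

Lemma orthant_l1sphere eps x : orthant eps x -> l1sphere x.
Proof.
rewrite /l1sphere => -[x0 <-]; apply: eq_bigr => j _.
by rewrite -[RHS]ger0_norm // normrMsign.
Qed.

Lemma l1sphere_flip f x : l1sphere x -> l1sphere (flip f x).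
Proof. by rewrite /l1sphere => <-; apply: eq_bigr => j _; rewrite mxE normrMsign. Qed.

Lemma l1sphere_le1 x j : l1sphere x -> `|x 0 j| <= 1.
Proof. by rewrite /l1sphere => <-; rewrite (bigD1 j) //= lerDl sumr_ge0. Qed.

Variables (K : nat) (c : nat -> 'I_d) (g : nat -> bool) (f : 'I_d -> bool).
Hypothesis c_inj : {in [pred i | (i <= K)%N] &, injective c}.

Definition pole k : V := (-1) ^+ g k *: delta_mx 0 (c k).

(** By injectivity of [c] a simplex has one pole per axis, so a single [eps] serves all its
    vertices. The sign at the apex is recorded because it places the hemisphere on one side. *)
Lemma hemi_vertices k s : (k <= K)%N -> s \in hemi (flip f) pole k ->
  exists2 eps : 'I_d -> bool, eps (c k) = g k & {in s, forall x,
    exists2 i, (i <= k)%N & x = (-1) ^+ eps (c i) *: delta_mx 0 (c i)}.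
Proof.
elim: k s => [|k IH] s kK.
  rewrite inE => /eqP->; exists (fun=> g 0) => // x; rewrite inE => /eqP->.
  by exists 0%N.
move=> /mapP[t tk ->].
have {tk IH} [eps epsP] : exists eps : 'I_d -> bool, {in t, forall x,
    exists2 i, (i <= k)%N & x = (-1) ^+ eps (c i) *: delta_mx 0 (c i)}.
  move: tk; rewrite mem_cat => /orP[/(IH _ (ltnW kK))[eps _]|]; first by exists eps.
  move=> /mapP[u /(IH _ (ltnW kK))[eps _ epsP] ->].
  exists (fun j => f j (+) eps j) => _ /mapP[x /epsP[i ik ->] ->]; exists i => //.
  apply/rowP => j; rewrite !mxE /= mulrA -signr_addb.
  by case: (j =P c i) => [->//|_]; rewrite !mulr0.
exists (fun j => if j == c k.+1 then g k.+1 else eps j); first by rewrite eqxx.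
move=> x; rewrite inE => /predU1P[->|/epsP[i ik ->]].
  by exists k.+1; rewrite ?eqxx.
exists i; first exact: ltnW.
case: eqP => // /c_inj; rewrite !inE => ci; suff: i = k.+1 by lia.
by apply: ci; lia.
Qed.

(** The vanishing coordinates will make [flip f] act as the antipode on hemispheres below the top
    dimension. *)
Lemma fine_orthant N k s : (k <= K)%N -> s \in fine_hemi (@bary R d) (flip f) pole N k ->
  exists2 eps : 'I_d -> bool, eps (c k) = g k & {in s, forall x,
    orthant eps x /\ forall j, (forall i, (i <= k)%N -> c i <> j) -> x 0 j = 0}.
Proof.
move=> kK; rewrite /fine_hemi; elim: N s => [|N IH] s.
  move=> /(hemi_vertices kK)[eps epsk epsP]; exists eps => // x /epsP[i ik ->].
  split; last first.
    move=> j cj; rewrite !mxE eqxx /=; case: (j =P c i) => [ji|]; last by rewrite mulr0.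
    by case: (cj i ik).
  split=> [j|].
    rewrite !mxE eqxx /=; case: (j =P c i) => [->|_]; last by rewrite !mulr0.
    by rewrite mulr1 -signr_addb addbb.
  rewrite (bigD1 (c i)) //= big1 ?addr0 => [|j /negbTE jc]; rewrite !mxE eqxx /=.
    by rewrite eqxx mulr1 -signr_addb addbb.
  by rewrite jc !mulr0.
rewrite iterS => /subdivP[t /IH[eps epsk epsP] ts]; exists eps => //.
apply: (sd_bary_closed _ ts) epsP => {t s ts}s s0 sP; split; last first.
  move=> j cj; rewrite baryE big_seq big1 ?mulr0 // => x /sP[_]; exact.
split=> [j|].
  by rewrite baryE mulrCA mulr_sumr; apply: mean_ge0 => x /sP[[]].
rewrite -[RHS](mean_cst 1 s0).
under eq_bigr do rewrite baryE mulrCA.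
rewrite -mulr_sumr; congr (_ * _).
under eq_bigr do rewrite mulr_sumr.
rewrite exchange_big /= big_seq [RHS]big_seq; apply: eq_bigr => x /sP[[_ ->]] //.
Qed.

Lemma fine_mesh e : 0 < e -> exists N, forall k s, (k <= K)%N ->
  s \in fine_hemi (@bary R d) (flip f) pole N k -> mesh_le e s.
Proof.
(* Coordinates are at most 1 in absolute value, so 2 bounds the initial mesh in every dimension and
   one [N] serves all [k]. *)
move=> e0; have [N Ne] := @iter_subdiv_small R d K 2 e (ler0n _ 2) e0.
exists N => k s kK; apply: Ne => t tk; split; first by rewrite (hemi_size tk).
have [eps _ epsP] := @fine_orthant 0 k t kK tk.
move=> x y /epsP[/orthant_l1sphere xl _] /epsP[/orthant_l1sphere yl _] j.
apply: le_trans (ler_normB _ _) _.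
by have := l1sphere_le1 j xl; have := l1sphere_le1 j yl; lra.
Qed.

End CrossPolytope.

(** * Lower bounds *)

Section Projection.
Local Open Scope classical_set_scope.
Variables (R : realType) (d : nat).
Local Notation V := 'rV[R]_d.+1.
Implicit Types (x y : V).

Definition norm2 x : R := Num.sqrt (\sum_i x 0 i ^+ 2).
Definition radial x : V := (norm2 x)^-1 *: x.

Lemma norm2_gt0 x j : x 0 j != 0 -> 0 < norm2 x.
Proof.
move=> xj; rewrite sqrtr_gt0 (bigD1 j) //= ltr_wpDr ?sumr_ge0 // => [i _|].
  exact: sqr_ge0.
by rewrite lt_neqAle sqr_ge0 eq_sym sqrf_eq0 xj.
Qed.

Lemma sphere_proj x : 0 < norm2 x -> sphere (radial x).
Proof.
move=> x0; rewrite /sphere; under eq_bigr do rewrite mxE exprMn.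
rewrite -mulr_sumr -[X in _ * X]sqr_sqrtr; last by rewrite sumr_ge0 // => i _; rewrite sqr_ge0.
by rewrite -/(norm2 x) -exprMn mulVf ?expr1n ?gt_eqF.
Qed.

Lemma norm2N x : norm2 (- x) = norm2 x.
Proof. by congr Num.sqrt; apply: eq_bigr => i _; rewrite mxE sqrrN. Qed.

Lemma projN x : radial (- x) = - radial x.
Proof. by rewrite /radial norm2N scalerN. Qed.

Lemma l1sphere_norm2 x : l1sphere x -> 0 < norm2 x.
Proof.
rewrite /l1sphere => x1.
have [[j xj]|x0] := pselect (exists j, x 0 j != 0); first exact: norm2_gt0 xj.
have : (0 : R) = 1.
  rewrite -x1 big1 // => j _; apply/eqP; rewrite normr_eq0; apply: contra_notT x0.
  by exists j.
by move/eqP; rewrite eq_sym oner_eq0.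
Qed.

Lemma cvg_sum_rV (f : 'I_d.+1 -> V -> R) x : (forall i, f i y @[y --> x] --> f i x) ->
  \sum_i f i y @[y --> x] --> \sum_i f i x.
Proof. by move=> fx; apply: cvg_big => //; [exact: add_continuous|exact: nbhs_filter]. Qed.

Lemma norm2_continuous x : norm2 y @[y --> x] --> norm2 x.
Proof.
apply: (@continuous_cvg _ _ _ _ _ _ Num.sqrt); [exact: nbhs_filter|exact: sqrt_continuous|].
apply: (@cvg_sum_rV (fun i y => y 0 i ^+ 2)) => i.
have c : y 0 i @[y --> x] --> x 0 i by exact: coord_continuous.
by rewrite expr2; under eq_fun do rewrite expr2; apply: cvgM => //; exact: nbhs_filter.
Qed.

Lemma edist_proj_continuous z x : 0 < norm2 x ->
  edist z (radial y) @[y --> x] --> edist z (radial x).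
Proof.
move=> x0; apply: (@continuous_cvg _ _ _ _ _ _ Num.sqrt); [exact: nbhs_filter|exact: sqrt_continuous|].
apply: (@cvg_sum_rV (fun i y => (z 0 i - radial y 0 i) ^+ 2)) => i.
have c : radial y 0 i @[y --> x] --> radial x 0 i.
  rewrite mxE; under eq_fun do rewrite mxE.
  apply: cvgM; [exact: nbhs_filter| |exact: coord_continuous].
  by apply: (@continuousV _ _ norm2 x); [rewrite gt_eqF|exact: norm2_continuous].
have {}c : z 0 i - radial y 0 i @[y --> x] --> z 0 i - radial x 0 i.
  by apply: cvgB => //; [exact: nbhs_filter|apply: cvg_cst; exact: nbhs_filter].
by rewrite expr2; under eq_fun do rewrite expr2; apply: cvgM => //; exact: nbhs_filter.
Qed.

Lemma proj_open (U : V -> Prop) x : sphere_open U -> 0 < norm2 x -> U (radial x) ->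
  exists2 e, 0 < e & forall y, (forall j, `|x 0 j - y 0 j| < e) -> U (radial y).
Proof.
move=> [_ Uo] x0 /Uo[r [r0 rU]].
have near_dist : \forall y \near x, edist (radial x) (radial y) < r.
  have := @edist_proj_continuous (radial x) x x0.
  rewrite {2}/edist big1 ?sqrtr0 => [/cvgr_lt/(_ r r0)//|i _].
  by rewrite subrr expr0n.
have near_pos : \forall y \near x, 0 < norm2 y.
  by have /cvgr_gt/(_ 0 x0) := @norm2_continuous x.
have /nbhs_ballP[e /= e0 eP] : \forall y \near x, edist (radial x) (radial y) < r /\ 0 < norm2 y.
  exact: filterI.
exists e => // y xy; have [] := eP y.
  by split => // i j; rewrite ord1 /ball /=; apply: xy.
by move=> yr y0; apply: rU => //; apply: sphere_proj.
Qed.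

Lemma l1sphere_compact : compact [set x : V | l1sphere x].
Proof.
apply: bounded_closed_compact.
  exists 1; split; first exact: num_real.
  move=> M M1 x /= xl; rewrite [leLHS]/Num.norm /= mx_normrE; apply/bigmax_leP; split.
    by rewrite ltW // (lt_trans _ M1).
  by move=> [i j] _ /=; rewrite ord1; apply: le_trans (l1sphere_le1 j xl) (ltW M1).
apply: (@closed_comp _ _ (fun x : V => \sum_j `|x 0 j|) [set t | t = 1]).
  move=> x _; apply: (@cvg_sum_rV (fun i y => `|y 0 i|)) => i.
  by apply: cvg_norm; [exact: nbhs_filter|exact: coord_continuous].
exact: closed_eq.
Qed.

Lemma lebesgue_number n (U : 'I_n -> V -> Prop) :
  (forall i, sphere_open (U i)) -> (forall x, sphere x -> exists i, U i x) ->
  exists2 e, 0 < e & forall x, l1sphere x -> exists i,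
    forall y, (forall j, `|x 0 j - y 0 j| <= e) -> U i (radial y).
Proof.
move=> Uo Uc.
pose P (e : R) (x : V) := exists i, forall y, (forall j, `|x 0 j - y 0 j| <= e) -> U i (radial y).
have /compact_near_coveringP := l1sphere_compact.
move=> /(_ R 0^'+ P _) cov.
have : \forall e \near 0^'+, [set x : V | l1sphere x] `<=` P e.
  apply: cov => x /l1sphere_norm2 x0.
  have [i Ux] := Uc _ (sphere_proj x0).
  have [e e0 eP] := proj_open (Uo i) x0 Ux.
  (* Half of [e] pays for moving the centre from [x] to [x'], half for the tolerance [t] around
     [x']. *)
  have e2 : 0 < e / 2 by rewrite divr_gt0.
  near=> x' t; exists i => y x'y; apply: eP => j.
  have xx' : ball x (e / 2) x' by near: x'; exact: nbhsx_ballx.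
  have te : t < e / 2 by near: t; exact: nbhs_right_lt.
  have := xx' => -[_ /(_ 0 j)]; rewrite /ball /= => xx'j.
  rewrite (splitr e) -(subrK (x' 0 j) (x 0 j)) -addrA.
  by apply: le_lt_trans (ler_normD _ _) _; apply: ltrD => //; apply: le_lt_trans (x'y j) te.
move=> cov'.
have [e []] : exists e : R, 0 < e /\ [set x : V | l1sphere x] `<=` P e.
  near (0 : R)^'+ => e; exists e; split; first by near: e; exact: nbhs_right_gt.
  by near: e.
by exists e.
Unshelve. all: by end_near. Qed.

End Projection.

Section LowerBound.
Variables (R : realType) (d n : nat).
Local Notation V := 'rV[R]_d.+1.
Implicit Types (x y z : V).
Variable U : 'I_n -> V -> Prop.
Hypotheses (Uopen : forall i, sphere_open (U i))
  (Uanti : forall i x, U i x -> U i (- x) -> False)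
  (Ucover : forall x, sphere x -> exists i, U i x).

(** With mesh at most the Lebesgue number, all sets named at the vertices of one simplex contain the
    projection of any single vertex. Only the axes below [K] must be flipped; the choice at the apex
    axis is free and distinguishes the two bounds. *)
Lemma cover_interlacing (K : nat) (c : nat -> 'I_d.+1) (g : nat -> bool) (f : 'I_d.+1 -> bool) :
  {in [pred i | (i <= K)%N] &, injective c} ->
  (forall i, (i < K)%N -> f (c i)) ->
  exists x : V, exists2 PQ : {set 'I_n} * {set 'I_n},
   [/\ l1sphere x, (-1) ^+ g K * x 0 (c K) >= 0, {in PQ.1, forall i, U i (radial x)} &
    {in PQ.2, forall i, U i (radial (flip f x))}] &
    (#|PQ.1| + #|PQ.2| = K.+2)%N /\ maxn #|PQ.1| #|PQ.2| = K.+1./2.+1.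
Proof.
move=> c_inj fc.
have [e e0 leb] := lebesgue_number Uopen Ucover.
(* A default index for points off the l1 sphere. *)
have [i0 _] : exists i : 'I_n, True.
  have x1 : l1sphere (delta_mx 0 0 : V).
    rewrite /l1sphere (bigD1 0) //= big1 ?addr0 => [|j /negbTE j0]; rewrite mxE eqxx /= ?normr1 //.
    by rewrite j0 normr0.
  by have [i _] := leb _ x1; exists i.
have /choice[lamI lamP] : forall x, exists i, l1sphere x ->
    forall y, (forall j, `|x 0 j - y 0 j| <= e) -> U i (radial y).
  move=> x; have [/leb[i iP]|nx] := pselect (l1sphere x); first by exists i.
  by exists i0.
pose lam x : nat := lamI x.
have [N meshN] := fine_mesh g f c_inj e0.
have sl1 k s x : (k <= K)%N -> s \in fine_hemi (@bary R _) (flip f) (pole _ c g) N k ->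
    x \in s -> l1sphere x.
  by move=> kK /(fine_orthant c_inj kK)[eps _ epsP] /epsP[/orthant_l1sphere].
(* Below dimension [K] the flip is the antipode, so equal labels would put a point and its antipode
   in one set. *)
have opp k s : (k < K)%N -> s \in fine_hemi (@bary R _) (flip f) (pole _ c g) N k ->
    {in s &, forall x y, lam x <> lam (flip f y)}.
  move=> kK sk x y xs ys /val_inj lamxy.
  have fy : flip f y = - y.
    have [eps _ /(_ y ys)[_ y0]] := fine_orthant c_inj (ltnW kK) sk.
    apply/rowP => j; rewrite !mxE.
    have [[i [ik ci]]|nj] := pselect (exists i, (i <= k)%N /\ c i = j).
      by rewrite -ci fc ?expr1 ?mulN1r // (leq_ltn_trans ik).
    by rewrite y0 ?mulr0 ?oppr0 // => i ik ci; apply: nj; exists i.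
  apply: (@Uanti (lamI x) (radial y)).
    by apply: lamP => //; [exact: sl1 (ltnW kK) sk xs|exact: meshN (ltnW kK) sk _ _ xs ys].
  rewrite lamxy fy -projN; apply: lamP; last by move=> j; rewrite subrr normr0 ltW.
  by rewrite -fy; apply: l1sphere_flip; apply: sl1 (ltnW kK) sk ys.
have := fan_interlacing (@bary_flip R _ f) (@flipK R _ f) opp.
move=> [s [P [Q [sK [uP uQ] sP sQ [szPQ maxPQ]]]]].
have [eps epsK epsP] := fine_orthant c_inj (leqnn K) sK.
have /hasP[x xs _] : has predT s by rewrite has_predT (fine_size sK).
pose toset (T : seq nat) := [set i : 'I_n | val i \in T].
have card_toset (T : seq nat) (h : V -> V) :
    uniq T -> {subset T <= map (lam \o h) s} -> #|toset T| = size T.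
  move=> uT sT; rewrite cardE -(size_map val); apply/perm_size/uniq_perm => //.
    by rewrite map_inj_uniq ?enum_uniq //; exact: val_inj.
  move=> j; apply/mapP/idP => [[i]|jT]; first by rewrite mem_enum inE => iT ->.
  have /mapP[y ys jy] := sT j jT.
  by move: jT; rewrite jy => jT; exists (lamI (h y)); rewrite ?mem_enum ?inE.
exists x, (toset P, toset Q); last by rewrite /= (card_toset P id) ?(card_toset Q (flip f)).
split; first exact: sl1 sK xs.
- by have [[xo _] _] := epsP x xs; rewrite -epsK.
- move=> i; rewrite inE => /sP/mapP[y ys /val_inj ->]; apply: lamP; first exact: sl1 sK ys.
  exact: meshN sK _ _ ys xs.
- move=> i; rewrite inE => /sQ/mapP[y ys /val_inj ->]; apply: lamP.
    by apply: l1sphere_flip; exact: sl1 sK ys.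
  move=> j; rewrite !mxE -mulrBr normrMsign.
  exact: meshN sK _ _ ys xs j.
Qed.

Lemma lusternik_schnirelmann : (d + 2 <= n)%N.
Proof.
have c_inj : {in [pred i | (i <= d)%N] &, injective (@inord d)}.
  by move=> i j; rewrite !inE => id jd /(congr1 val) /=; rewrite !inordK.
have [x [[P Q] /= [_ _ xP xQ] [cPQ _]]] :=
  cover_interlacing (fun=> true) c_inj (fun i _ => erefl : (fun=> true) (inord i : 'I_d.+1)).
have PQ0 : P :&: Q = finset.set0.
  apply/setP => i; rewrite !inE; apply/negP => /andP[/xP Ux /xQ].
  rewrite (_ : flip _ x = - x) ?projN; first exact: Uanti Ux.
  by apply/rowP => j; rewrite !mxE expr1 mulN1r.
have := max_card (P :|: Q); rewrite card_ord cardsU PQ0 cards0 subn0 cPQ.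
by rewrite addn2.
Qed.

Lemma south_multiplicity : (1 <= d)%N ->
  exists z : V, exists2 P : {set 'I_n}, l1sphere z /\ z 0 ord_max <= 0 &
    #|P| = ((d - 1)./2 + 2)%N /\ {in P, forall i, U i (radial z)}.
Proof.
(* The odd [K] gives [K + 2 = 2r + 3] labels, so one side has [r + 2]. Below, the last axis [c K] is
   vertical and its sign, constantly [true], makes the apex the south pole. *)
move=> d1; pose r := (d - 1)./2; pose K := r.*2.+1.
have Kd : (K <= d)%N by rewrite /K /r; lia.
pose c i : 'I_d.+1 := if (i < K)%N then inord i else ord_max.
have cK : c K = ord_max by rewrite /c ltnn.
have cval i : (i < K)%N -> c i = i :> nat by move=> iK; rewrite /c iK inordK //; lia.
have cN i : (i < K)%N -> c i != ord_max.
  by move=> iK; apply/eqP => /(congr1 val); rewrite /= cval //; lia.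
have c_inj : {in [pred i | (i <= K)%N] &, injective c}.
  move=> i j; rewrite !inE leq_eqVlt => /predU1P[->|iK]; rewrite leq_eqVlt => /predU1P[->|jK] //.
  - by move=> cij; move: (cN j jK); rewrite -cij cK eqxx.
  - by move=> cij; move: (cN i iK); rewrite cij cK eqxx.
  - by move=> /(congr1 val); rewrite /= !cval.
have [x [[P Q] /= [xl xs xP xQ] [_ mPQ]]] := @cover_interlacing K c (fun=> true) (fun j => j != ord_max) c_inj cN.
have {xs} xs : x 0 ord_max <= 0 by move: xs; rewrite cK expr1 mulN1r oppr_ge0.
have {mPQ} mPQ : maxn #|P| #|Q| = (r + 2)%N by rewrite mPQ /K /= doubleK addn2.
(* The flip fixes the height, so [x] and its image are both southern and the larger family can be
   taken. *)
have [PQ|QP] := leqP #|P| #|Q|.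
  exists (flip (fun j => j != ord_max) x), Q; split => //.
  - exact: l1sphere_flip.
  - by rewrite mxE eqxx expr0 mul1r.
  - by rewrite -mPQ; apply/esym/maxn_idPr.
by exists x, P; split => //; rewrite -mPQ; apply/esym/maxn_idPl; exact: ltnW.
Qed.

Lemma north_count m : (1 <= d)%N ->
  (forall x, sphere x -> north x ->
     exists S : {set 'I_n}, (m <= #|S|)%N /\ forall i, i \in S -> U i x) ->
  ((d - 1)./2 + 2 + m <= n)%N.
Proof.
move=> d1 Unorth; have [z [P [zl zs] [cP zP]]] := south_multiplicity d1.
have [e e0 eP] : exists2 e, 0 < e & forall y, (forall j, `|z 0 j - y 0 j| < e) ->
    {in P, forall i, U i (radial y)}.
  have : exists2 e, 0 < e & forall y, (forall j, `|z 0 j - y 0 j| < e) ->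
      {in enum P, forall i, U i (radial y)}.
    have : {in enum P, forall i, U i (radial z)} by move=> i; rewrite mem_enum; apply: zP.
    elim: (enum P) => [|i s IH] H; first by exists 1.
    have [j js|e e0 eP] := IH; first by apply: H; rewrite inE js orbT.
    have [|e' e'0 e'P] := @proj_open _ _ (U i) z (Uopen i) (l1sphere_norm2 zl).
      by apply: H; rewrite inE eqxx.
    exists (Num.min e e'); first by rewrite lt_min e0 e'0.
    move=> y ye j; rewrite inE => /predU1P[->|js].
      by apply: e'P => l; have := ye l; rewrite lt_min => /andP[].
    by apply: eP => // l; have := ye l; rewrite lt_min => /andP[].
  by move=> [e e0 eP]; exists e => // y ye i iP; apply: eP; rewrite ?mem_enum.
(* [z] may lie on the equator; this shift makes it strictly southern without leaving the sets of
   [P]. *)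
pose y : V := z - (e / 2) *: delta_mx 0 ord_max.
have yP : {in P, forall i, U i (radial y)}.
  apply: eP => j; rewrite !mxE eqxx /= opprB addrC subrK.
  rewrite normrM gtr0_norm ?divr_gt0 //; case: eqP => _; rewrite ?normr1 ?normr0; lra.
have ys : y 0 ord_max < 0 by rewrite !mxE !eqxx /=; lra.
have y0 : 0 < norm2 y by apply: (@norm2_gt0 _ _ _ ord_max); rewrite lt_eqF.
have ysph : sphere (radial (- y)) by apply: sphere_proj; rewrite norm2N.
have [|S [mS SP]] := Unorth _ ysph.
  by rewrite /north !mxE norm2N mulr_gt0 ?invr_gt0 // oppr_gt0; move: ys; rewrite !mxE.
have PS0 : P :&: S = finset.set0.
  apply/setP => i; rewrite !inE; apply/negP => /andP[/yP Ux /SP].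
  by rewrite projN; exact: Uanti Ux.
have := max_card (P :|: S); rewrite card_ord cardsU PS0 cards0 subn0 cP.
lia.
Qed.

End LowerBound.

(** * Construction of covers *)

Section OrderStatistics.
Variables (R : realDomainType) (n : nat).
Implicit Types (v w : 'I_n.+1 -> R) (c e : R) (p : nat).

(** Counting entries on both sides determines the value with multiplicity, so ties are harmless. *)
Definition kth_largest p v c : Prop :=
  (p <= #|[set i | (c <= v i)%R]| /\ #|[set i | (c < v i)%R]| < p)%N.

(** Take the greatest entry with at least [p] entries at or above it. If [p] entries exceeded it,
    the least of all those exceeding it would be a greater such entry. *)
Lemma kth_largest_exists p v : (0 < p <= n.+1)%N -> exists c, kth_largest p v c.
Proof.
move=> /andP[p0 pn].
pose P j := (p <= #|[set i | (v j <= v i)%R]|)%N.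
have [j0 Pj0] : exists j, P j.
  case: (@arg_minP _ _ _ ord0 xpredT v isT) => j _ jmin.
  exists j; rewrite /P (_ : [set i | _] = finset.setT) ?cardsT ?card_ord //.
  by apply/finset.setP => i; rewrite !inE jmin.
case: (@arg_maxP _ _ _ j0 P v Pj0) => j Pj jmax; exists (v j); split => //.
rewrite ltnNge; apply/negP => pS.
have /card_gt0P[i0 i0S] := leq_trans p0 pS.
case: (@arg_minP _ _ _ i0 (fun i => i \in [set i | v j < v i]) v i0S) => l lS lmin.
have : v l <= v j.
  apply: jmax; apply: leq_trans pS (subset_leq_card _).
  by apply/fintype.subsetP => i iS; rewrite inE; apply: lmin.
by move: lS; rewrite inE ltNge => /negbTE->.
Qed.

Lemma kth_largest_lipschitz p v w c c' e : kth_largest p v c -> kth_largest p w c' ->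
  (forall i, v i <= w i + e) -> c <= c' + e.
Proof.
move=> [pc _] [_ c'p] vw; rewrite leNgt; apply/negP => cc'.
move: c'p; rewrite ltnNge => /negP; apply; apply: leq_trans pc (subset_leq_card _).
by apply/fintype.subsetP => i; rewrite !inE => ci; have := vw i; lra.
Qed.

(** Here [- c'] is the [p]-th smallest entry. Were it above [c], every index would be among the
    fewer than [p] entries above [c] or the fewer than [p] below [- c'], at most [2p - 2 <= n] in
    all. *)
Lemma kth_largest_opp p v c c' : (p.*2 <= n.+2)%N -> kth_largest p v c ->
  kth_largest p (fun i => - v i) c' -> - c' <= c.
Proof.
move=> pn [_ cp] [_ c'p]; rewrite leNgt; apply/negP => cc'.
have : (#|'I_n.+1| <= #|[set i | (c < v i)%R] :|: [set i | (c' < - v i)%R]|)%N.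
  rewrite -cardsT; apply/subset_leq_card/fintype.subsetP => i _; rewrite !inE.
  by case: (ltP c (v i)) => //= ?; lra.
have [] := leq_card_setU [set i | c < v i] [set i | c' < - v i].
by rewrite card_ord; lia.
Qed.

End OrderStatistics.

(** * Odd Lipschitz functions whose positivity sets form the cover *)

Section Construction.
Variables (R : realType) (d : nat).
Local Notation V := 'rV[R]_d.+1.
Implicit Types (x z : V).

Lemma edist_coord x z j : `|x 0 j - z 0 j| <= edist x z.
Proof.
rewrite -sqrtr_sqr ler_sqrt ?sumr_ge0 // => [|i _]; last exact: sqr_ge0.
by rewrite (bigD1 j) //= lerDl sumr_ge0 // => i _; exact: sqr_ge0.
Qed.

(** In the sup distance the threshold changes by at most [2 * e], an entry or the midrange by at
    most [e]; the factor 4 covers every gauge below. *)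
Definition lipschitz4 (h : V -> R) : Prop :=
  forall x z e, (forall j, `|x 0 j - z 0 j| <= e) -> h x <= h z + 4 * e.

Lemma sphere_open_pos (h : V -> R) : lipschitz4 h ->
  sphere_open (fun x => sphere x /\ 0 < h x).
Proof.
move=> hL; split=> [x []//|x [_ hx]]; exists (h x / 4); split; first lra.
move=> z zs xz; split => //.
by have := hL x z _ (fun j => edist_coord x z j); lra.
Qed.

(** The height is replaced by 0 rather than dropped: if all entries agree, this zero fixes their
    common value. *)
Definition horizontal x (j : 'I_d.+1) : R := if j == ord_max then 0 else x 0 j.

Lemma horizontalN x : horizontal (- x) = fun j => - horizontal x j.
Proof. by apply/funext => j; rewrite /horizontal mxE; case: eqP; rewrite ?oppr0. Qed.

Lemma horizontal_dist x z e j : (forall j, `|x 0 j - z 0 j| <= e) ->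
  `|horizontal x j - horizontal z j| <= e.
Proof.
move=> xz; rewrite /horizontal; case: eqP => // _; rewrite subrr normr0.
exact: le_trans (normr_ge0 _) (xz ord0).
Qed.

Variables (p : nat) (a b : ('I_d.+1 -> R) -> R).
Hypotheses (p0 : (0 < p)%N) (pd : (p.*2 <= d.+2)%N)
  (aP : forall v, kth_largest p v (a v)) (bP : forall v, kth_largest 1 v (b v)).

(* Subtracting the height puts at least [p] entries above the threshold in the north. *)
Definition threshold x : R :=
  (a (horizontal x) - a (fun j => - horizontal x j)) / 2 - x 0 ord_max.

Definition midrange x : R :=
  (b (horizontal x) - b (fun j => - horizontal x j)) / 2.

Lemma thresholdN x : threshold (- x) = - threshold x.
Proof.
rewrite /threshold horizontalN mxE.
rewrite (_ : (fun j => - - horizontal x j) = horizontal x); last by apply/funext => j; rewrite opprK.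
lra.
Qed.

Lemma midrangeN x : midrange (- x) = - midrange x.
Proof.
rewrite /midrange horizontalN.
rewrite (_ : (fun j => - - horizontal x j) = horizontal x); last by apply/funext => j; rewrite opprK.
lra.
Qed.

Lemma kth_dist q (f : ('I_d.+1 -> R) -> R) x z e : (forall v, kth_largest q v (f v)) ->
  (forall j, `|x 0 j - z 0 j| <= e) ->
  `|f (horizontal x) - f (horizontal z)| <= e /\
  `|f (fun j => - horizontal x j) - f (fun j => - horizontal z j)| <= e.
Proof.
move=> fP xz.
have H j : horizontal x j <= horizontal z j + e /\ horizontal z j <= horizontal x j + e.
  by have := horizontal_dist j xz; rewrite ler_norml => /andP[]; split; lra.
rewrite !ler_norml.
have := kth_largest_lipschitz (fP (horizontal x)) (fP (horizontal z)) (fun j => proj1 (H j)).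
have := kth_largest_lipschitz (fP (horizontal z)) (fP (horizontal x)) (fun j => proj2 (H j)).
have : f (fun j => - horizontal x j) <= f (fun j => - horizontal z j) + e.
  by apply: kth_largest_lipschitz (fP _) (fP _) _ => j; have := H j; lra.
have : f (fun j => - horizontal z j) <= f (fun j => - horizontal x j) + e.
  by apply: kth_largest_lipschitz (fP _) (fP _) _ => j; have := H j; lra.
by move=> *; split; apply/andP; split; lra.
Qed.

Definition gauge q (i : 'I_(d.+1 + q.+1)) x : R :=
  match split i with
  | inl j => horizontal x j - threshold x
  | inr j => if j == ord0 then threshold x - midrange x else x 0 ord_max
  end.

(** Oddness keeps the set where a gauge is positive free of antipodal pairs. *)
Lemma gaugeN q (i : 'I_(d.+1 + q.+1)) x : gauge i (- x) = - gauge i x.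
Proof.
rewrite /gauge; case: split => j; last case: eqP => _.
- by rewrite horizontalN thresholdN; lra.
- by rewrite thresholdN midrangeN; lra.
- by rewrite mxE.
Qed.

Lemma gauge_lipschitz q (i : 'I_(d.+1 + q.+1)) : lipschitz4 (gauge i).
Proof.
move=> x z e xz.
have [a1 a2] := kth_dist aP xz; have [b1 b2] := kth_dist bP xz.
have l := xz ord_max; have h j := horizontal_dist j xz.
move: a1 a2 b1 b2 l; rewrite !ler_norml => /andP[? ?] /andP[? ?] /andP[? ?] /andP[? ?] /andP[? ?].
rewrite /gauge /threshold /midrange; case: split => j; last case: eqP => _; try lra.
by have := h j; rewrite ler_norml => /andP[? ?]; lra.
Qed.

(** If no entry exceeds the threshold, it is at least the maximum, hence at least the midrange.
    Equality would make all entries equal to it, hence zero, and then the height vanishes too, which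
    is impossible on the sphere. *)
Lemma gauge_cover q x : sphere x -> exists i : 'I_(d.+1 + q.+1), 0 < gauge i x.
Proof.
move=> xs.
have [[j jt]|nt] := pselect (exists j, threshold x < horizontal x j).
  by exists (lshift _ j); rewrite /gauge (unsplitK (inl _ j)) subr_gt0.
have {nt} yt j : horizontal x j <= threshold x.
  by rewrite leNgt; apply/negP => H; apply: nt; exists j.
exists (rshift _ ord0); rewrite /gauge (unsplitK (inr _ ord0)) eqxx subr_gt0.
have [bx1 bx2] := bP (horizontal x).
have [_ bx3] := bP (fun j => - horizontal x j).
have bt : b (horizontal x) <= threshold x.
  by have /card_gt0P[j] := bx1; rewrite inE => /le_trans; apply.
have bb : - b (fun j => - horizontal x j) <= b (horizontal x).
  by apply: (kth_largest_opp _ (bP _) (bP _)).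
rewrite ltNge; apply/negP => mid.
have up j : horizontal x j <= b (horizontal x).
  rewrite leNgt; apply/negP => H; move: bx2; rewrite ltnS leqn0 cards_eq0 => /eqP/finset.setP/(_ j).
  by rewrite !inE H.
have low j : - b (fun j => - horizontal x j) <= horizontal x j.
  rewrite leNgt; apply/negP => H; move: bx3; rewrite ltnS leqn0 cards_eq0 => /eqP/finset.setP/(_ j).
  by rewrite !inE ltrNr H.
have yc j : horizontal x j = threshold x.
  by apply/eqP; rewrite eq_le yt /=; have := low j; move: mid; rewrite /midrange; lra.
have t0 : threshold x = 0 by rewrite -(yc ord_max) /horizontal eqxx.
have kth0 v : (forall j, v j = 0) -> a v = 0.
  move=> v0; have [a1 a2] := aP v; apply/eqP; rewrite eq_le; apply/andP; split.
    by have /card_gt0P[j] := leq_trans p0 a1; rewrite inE v0.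
  rewrite leNgt; apply/negP => H; move: a2; rewrite ltnNge => /negP; apply.
  rewrite (_ : [set i | _] = finset.setT) ?cardsT ?card_ord; first by lia.
  by apply/finset.setP => j; rewrite !inE v0 H.
have x0 : x 0 ord_max = 0.
  have := t0; rewrite /threshold !kth0 => [|j|j]; rewrite ?yc ?t0 ?oppr0 //; lra.
move: xs; rewrite /sphere big1 => [/eqP|j _]; first by rewrite eq_sym oner_eq0.
have [->|jm] := eqVneq j ord_max; first by rewrite x0 expr0n.
by have := yc j; rewrite /horizontal (negbTE jm) t0 => ->; rewrite expr0n.
Qed.

(** By [kth_largest_opp] the average in the threshold is at most the [p]-th largest entry;
    subtracting a positive height puts it strictly below [p] entries. The [q] copies of the
    hemisphere add the rest. *)
Lemma gauge_north q x : north x ->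
  exists S : {set 'I_(d.+1 + q.+1)}, (p + q <= #|S|)%N /\ forall i, i \in S -> 0 < gauge i x.
Proof.
rewrite /north => xn.
have aa := kth_largest_opp pd (aP (horizontal x)) (aP _).
pose A := [set j | a (horizontal x) <= horizontal x j].
exists ([set @lshift _ q.+1 j | j in A] :|: [set @rshift d.+1 _ j | j in [set~ ord0]]).
split; last first.
  move=> i; rewrite inE => /orP[|] /imsetP[j jS ->]; rewrite /gauge.
    rewrite (unsplitK (inl _ j)); move: jS; rewrite inE /threshold; lra.
  by rewrite (unsplitK (inr _ j)); move: jS; rewrite !inE => /negbTE->.
rewrite cardsU (_ : _ :&: _ = finset.set0) ?cards0 ?subn0; last first.
  apply/finset.setP => i; rewrite !inE; apply/negP => /andP[/imsetP[j _ ->] /imsetP[l _]].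
  by move/eqP; rewrite eq_lrshift.
rewrite !card_imset; [|exact: rshift_inj|exact: lshift_inj].
by rewrite leq_add ?(aP _).1 // cardsC1 card_ord.
Qed.

End Construction.

Lemma cover_exists (R : realType) (d m q : nat) : (m <= d./2 + 1 + q)%N ->
  exists U : 'I_(d.+1 + q.+1) -> 'rV[R]_d.+1 -> Prop, antipodal_open_1m_cover m U.
Proof.
(* The largest [p] with [2p <= d + 2], the condition of [kth_largest_opp]. *)
move=> mq; pose p := (d./2 + 1)%N.
have /choice[a aP] : forall v : 'I_d.+1 -> R, exists c, kth_largest p v c.
  by move=> v; apply: kth_largest_exists; rewrite /p; lia.
have /choice[b bP] : forall v : 'I_d.+1 -> R, exists c, kth_largest 1 v c.
  by move=> v; apply: kth_largest_exists.
have p0 : (0 < p)%N by rewrite /p addn1.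
have pd : (p.*2 <= d.+2)%N by rewrite /p; lia.
exists (fun i x => sphere x /\ 0 < gauge a b i x); split.
- by move=> i; apply: sphere_open_pos; apply: (gauge_lipschitz aP bP).
- by move=> i x [_ gx] [_]; rewrite gaugeN; lra.
- by move=> x xs; have [i ix] := gauge_cover p0 pd aP bP q xs; exists i.
move=> x xs xn; have [S [cS SP]] := gauge_north b pd aP q xn.
exists S; split; first exact: leq_trans mq cS.
by move=> i /SP.
Qed.

Theorem theorem4 (R : realType) (d m : nat) :
  (2 <= d)%N -> (2 <= m)%N ->
  let k := if (m <= d./2 + 1)%N then (d + 2)%N else ((d - 1)./2 + 2 + m)%N in
  (exists U : 'I_k -> 'rV[R]_(d.+1) -> Prop, @antipodal_open_1m_cover R d m _ U) /\
  (forall n : nat, (n < k)%N ->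
     ~ exists U : 'I_n -> 'rV[R]_(d.+1) -> Prop, @antipodal_open_1m_cover R d m _ U).
Proof.
move=> d2 m2 k; split.
  (* The number of hemisphere copies is [k - (d + 2)]: none in the first case, [m - (d./2 + 1)] in
     the second. *)
  have kE : k = (d.+1 + (k - d.+2).+1)%N by rewrite /k; case: ifP; lia.
  rewrite kE; apply: cover_exists; rewrite /k; case: ifP; lia.
move=> n nk [U [Uo Ua Uc Un]].
have LS := lusternik_schnirelmann Uo Ua Uc.
have N := north_count Uo Ua Uc (ltnW d2) Un.
by move: nk; rewrite /k; case: ifP; lia.
Qed.
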